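(* For $K_{n_1,\dots,n_r}\neq K_1$, we have $\operatorname{depth}_E K_{n_1,\dots,n_r}=0$.
   Context: Let $\mathbf{k}$ be an algebraically closed field of characteristic zero. Graphs are finite and simple. The complete $r$-partite graph $K_{n_1,\dots,n_r}$ is a graph whose vertices can be partitioned into $r$ disjoint sets of cardinalities $n_1,\dots,n_r$ so that no two vertices in the same set are adjacent and there is an edge between every pair of vertices from different sets. The complete graph $K_n$ is the graph with $n$ vertices in which every vertex is adjacent to every other vertex; in particular $K_1$ is the graph with a single vertex, and $K_{1,\dots,1}=K_r$ (with $r$ ones). For a graph $G$ with vertices $v_1,\dots,v_n$, let $E=\bigwedge_{\mathbf k}\langle e_1,\dots,e_n\rangle$ be the exterior algebra over $\mathbf{k}$ in $n$ variables, with degree-one part $E_1$, and let $I_E(G)=(e_ie_j \mid \{v_i,v_j\}\text{ is an edge of }G)\subseteq E$ be the exterior edge ideal. For a graded $E$-module $M$, an element $\ell\in E_1$ is $M$-regular if $\{m\in M\mid \ell m=0\}=\ell M$. A sequence $\ell_1,\dots,\ell_s\in E_1$ is an $M$-regular sequence if $\ell_i$ is regular on $M/(\ell_1,\dots,\ell_{i-1})M$ for all $i\le s$; $\operatorname{depth}_E M$ is the maximum length of an $M$-regular sequence. Write $\operatorname{depth}_E G=\operatorname{depth}_E E/I_E(G)$. *)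

(* Defs.v *)
Set Warnings "-notation-overridden,-ambiguous-paths".
From HB Require Import structures.
From mathcomp Require Import all_boot all_order all_algebra.
From mathcomp Require Import boolp.

Set Implicit Arguments.
Unset Strict Implicit.
Unset Printing Implicit Defensive.

Import GRing.Theory.
Local Open Scope ring_scope.

(* The exterior algebra on e_0, ..., e_(n-1): an element is the family of its  *)
(* coordinates on the basis e_S = e_i1 * ... * e_ip, where S = {i1 < ... < ip}.*)

Definition extalg (k : fieldType) (n : nat) := {ffun {set 'I_n} -> k}.

Section ExteriorAlgebra.
Variables (k : fieldType) (n : nat).
Local Notation E := (extalg k n).
Implicit Types (a b c : E) (S T U V W : {set 'I_n}).

HB.instance Definition _ := GRing.Lmodule.copy E {ffun {set 'I_n} -> k^o}.

(* The number of transpositions needed to sort the concatenation of S and T.  *)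
Definition ext_inv S T : nat := \sum_(i in S) \sum_(j in T) (j < i)%N.

(* e_S * e_T = (-1) ^ ext_inv S T e_(S U T) if S and T are disjoint, else 0.   *)
Definition ext_coef S T U : k :=
  if (S :&: T == set0) && (S :|: T == U) then (-1) ^+ ext_inv S T else 0.

Definition ext_one : E := [ffun S => (S == set0)%:R].
Definition ext_mul a b : E :=
  [ffun U => \sum_S \sum_T a S * b T * ext_coef S T U].

Lemma ext_inv0l T : ext_inv set0 T = 0%N.
Proof. by rewrite /ext_inv big_set0. Qed.

Lemma ext_inv0r S : ext_inv S set0 = 0%N.
Proof. by rewrite /ext_inv big1 // => i _; rewrite big_set0. Qed.

Lemma big_disjU S T (F : 'I_n -> nat) : S :&: T = set0 ->
  (\sum_(i in S :|: T) F i = \sum_(i in S) F i + \sum_(i in T) F i)%N.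
Proof.
move=> ST0; rewrite -bigU /=; last by rewrite -setI_eq0 ST0.
by apply: eq_bigl => i; rewrite !inE.
Qed.

Lemma ext_invUl S T V : S :&: T = set0 ->
  ext_inv (S :|: T) V = (ext_inv S V + ext_inv T V)%N.
Proof. by move=> ST0; rewrite /ext_inv big_disjU. Qed.

Lemma ext_invUr S T V : T :&: V = set0 ->
  ext_inv S (T :|: V) = (ext_inv S T + ext_inv S V)%N.
Proof.
move=> TV0; rewrite /ext_inv -big_split /=; apply: eq_bigr => i _.
by rewrite big_disjU.
Qed.

Lemma ext_coef_assoc S T V U :
  \sum_W ext_coef S T W * ext_coef W V U =
  \sum_W ext_coef T V W * ext_coef S W U.
Proof.
rewrite (bigD1 (S :|: T)) //= [X in _ + X]big1 ?addr0; last first.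
  by move=> W neW; rewrite /ext_coef [_ == W]eq_sym (negPf neW) andbF mul0r.
rewrite [RHS](bigD1 (T :|: V)) //= [X in _ + X]big1 ?addr0; last first.
  by move=> W neW; rewrite /ext_coef [_ == W]eq_sym (negPf neW) andbF mul0r.
rewrite /ext_coef !eqxx !andbT setUA.
rewrite setIUl setIUr !setU_eq0.
case: (S :|: T :|: V == U); rewrite ?andbF ?mulr0 // !andbT.
have [ST|_] := eqVneq (S :&: T); have [TV|_] := eqVneq (T :&: V);
  have [SV|_] := eqVneq (S :&: V); rewrite ?mulr0 ?mul0r //=.
rewrite -!exprD ext_invUl // ext_invUr //; congr (_ ^+ _).
by rewrite addnA addnC addnA.
Qed.

Lemma ext_mulA : associative ext_mul.
Proof.
move=> a b c; apply/ffunP => U; rewrite !ffunE.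
transitivity (\sum_S \sum_T \sum_V a S * b T * c V *
                 \sum_W ext_coef T V W * ext_coef S W U).
  apply: eq_bigr => S _.
  under eq_bigr => W _ do rewrite ffunE mulr_sumr mulr_suml.
  rewrite exchange_big /=; apply: eq_bigr => T _.
  under eq_bigr => W _ do rewrite mulr_sumr mulr_suml.
  rewrite exchange_big /=; apply: eq_bigr => V _.
  by rewrite mulr_sumr; apply: eq_bigr => W _; rewrite !mulrA.
under [RHS]eq_bigr => W _.
  under eq_bigr => V _.
    rewrite ffunE !mulr_suml.
    under eq_bigr => S _ do rewrite !mulr_suml.
    over.
  over.
rewrite [RHS]exchange_big /=.
under [RHS]eq_bigr => V _.
  rewrite exchange_big /=.
  under eq_bigr => S _ do rewrite exchange_big /=.
  over.
rewrite [RHS]exchange_big /=; apply: eq_bigr => S _.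
rewrite [RHS]exchange_big /=; apply: eq_bigr => T _; apply: eq_bigr => V _.
rewrite -ext_coef_assoc mulr_sumr; apply: eq_bigr => W _.
by rewrite mulrACA !mulrA.
Qed.

Lemma ext_mul1 : left_id ext_one ext_mul.
Proof.
move=> a; apply/ffunP => U; rewrite ffunE (bigD1 set0) //=.
rewrite [X in _ + X]big1 ?addr0; last first.
  by move=> S /negPf neS; rewrite big1 // => T _; rewrite ffunE neS !mul0r.
rewrite (bigD1 U) //= [X in _ + X]big1 ?addr0; last first.
  move=> T /negPf neT; rewrite /ext_coef set0U neT andbF mulr0 //.
by rewrite ffunE /ext_coef set0U set0I !eqxx ext_inv0l mul1r mulr1.
Qed.

Lemma ext_mulr1 : right_id ext_one ext_mul.
Proof.
move=> a; apply/ffunP => U; rewrite ffunE exchange_big /= (bigD1 set0) //=.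
rewrite [X in _ + X]big1 ?addr0; last first.
  by move=> S /negPf neS; rewrite big1 // => T _; rewrite ffunE neS mulr0 mul0r.
rewrite (bigD1 U) //= [X in _ + X]big1 ?addr0; last first.
  move=> T /negPf neT; rewrite /ext_coef setU0 neT andbF mulr0 //.
by rewrite ffunE /ext_coef setU0 setI0 !eqxx ext_inv0r !mulr1.
Qed.

Lemma ext_mulDl : left_distributive ext_mul +%R.
Proof.
move=> a b c; apply/ffunP => U; rewrite !ffunE -big_split; apply: eq_bigr => S _.
by rewrite -big_split; apply: eq_bigr => T _; rewrite ffunE !mulrDl.
Qed.

Lemma ext_mulDr : right_distributive ext_mul +%R.
Proof.
move=> a b c; apply/ffunP => U; rewrite !ffunE -big_split; apply: eq_bigr => S _.
by rewrite -big_split; apply: eq_bigr => T _; rewrite ffunE mulrDr mulrDl.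
Qed.

Lemma ext_one_neq0 : ext_one != 0.
Proof.
by apply/eqP => /ffunP/(_ set0)/eqP; rewrite !ffunE eqxx oner_eq0.
Qed.

HB.instance Definition _ := GRing.Zmodule_isNzRing.Build E
  ext_mulA ext_mul1 ext_mulr1 ext_mulDl ext_mulDr ext_one_neq0.

Lemma ext_scaleAl (x : k) a b : x *: (a * b) = (x *: a) * b.
Proof.
apply/ffunP => U; rewrite !ffunE scaler_sumr; apply: eq_bigr => S _.
by rewrite scaler_sumr; apply: eq_bigr => T _; rewrite ffunE !scalerAl.
Qed.

HB.instance Definition _ := GRing.Lmodule_isLalgebra.Build k E ext_scaleAl.

Lemma ext_scaleAr (x : k) a b : x *: (a * b) = a * (x *: b).
Proof.
apply/ffunP => U; rewrite !ffunE scaler_sumr; apply: eq_bigr => S _.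
rewrite scaler_sumr; apply: eq_bigr => T _; rewrite ffunE.
by rewrite scalerAl scalerAr.
Qed.

HB.instance Definition _ := GRing.Lalgebra_isAlgebra.Build k E ext_scaleAr.

Definition ext_basis S : E := [ffun T => (T == S)%:R].
Definition ext_gen (i : 'I_n) : E := ext_basis [set i].

Lemma ext_basisM S T :
  ext_basis S * ext_basis T =
  if S :&: T == set0 then (-1) ^+ ext_inv S T *: ext_basis (S :|: T) else 0.
Proof.
apply/ffunP => U; rewrite ffunE (bigD1 S) //= [X in _ + X]big1 ?addr0; last first.
  by move=> W /negPf neW; rewrite big1 // => V _; rewrite ffunE neW !mul0r.
rewrite (bigD1 T) //= [X in _ + X]big1 ?addr0; last first.
  by move=> W /negPf neW; rewrite [ext_basis T W]ffunE neW mulr0 mul0r.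
rewrite !ffunE !eqxx !mul1r /ext_coef [_ == U]eq_sym.
case: eqP => _ /=; last by rewrite ffunE.
by rewrite !ffunE; case: eqP => _; rewrite ?scaler0 // /GRing.scale /= mulr1.
Qed.

Lemma ext_gen_sqr i : ext_gen i * ext_gen i = 0.
Proof.
by rewrite ext_basisM setIid -subset0 sub1set inE.
Qed.

Lemma ext_gen_anticomm i j : ext_gen i * ext_gen j = - (ext_gen j * ext_gen i).
Proof.
have [->|neij] := eqVneq i j; first by rewrite ext_gen_sqr oppr0.
have dij u v : u != v -> [set u] :&: [set v] == set0 :> {set 'I_n}.
  by move=> neuv; rewrite setI_eq0 disjoints1 inE.
rewrite !ext_basisM (dij i j) // (dij j i) 1?eq_sym // -scaleNr setUC.
congr (_ *: _); rewrite /ext_inv !big_set1.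
by case: (ltngtP i j) => [||/val_inj/eqP]; rewrite ?opprK ?(negPf neij).
Qed.

Definition ext_homog (d : nat) : {pred E} :=
  fun a => [forall S, (a S != 0) ==> (#|S| == d)].

End ExteriorAlgebra.

Section Modules.
Variables (R : nzRingType) (M : lmodType R).

Section Span.
Variable X : M -> Prop.

(* The smallest submodule containing X.                                       *)
Definition span_mod : {pred M} := fun m =>
  `[< forall N : submodClosed M, (forall x, X x -> x \in N) -> m \in N >].

Lemma span_mod_closed : submod_closed span_mod.
Proof.
split=> [|x u v /asboolP uX /asboolP vX]; apply/asboolP => N XN.
  exact: rpred0.
by apply: rpredD; [apply: rpredZ; apply: uX | apply: vX].
Qed.

HB.instance Definition _ := GRing.isSubmodClosed.Build R M span_mod
  span_mod_closed.
End Span.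

Variable N : submodClosed M.

(* N as a subgroup: submodClosed does not coerce to zmodClosed.                *)
Definition submod_zmod : {pred M} := fun m => m \in N.

Lemma submod_zmod_closed : zmod_closed submod_zmod.
Proof. exact: GRing.submod_closedB (submodClosedP N). Qed.

HB.instance Definition _ := GRing.isZmodClosed.Build M submod_zmod
  submod_zmod_closed.

Definition quot_mod := Quotient.quot submod_zmod.
HB.instance Definition _ := GRing.Zmodule.on quot_mod.
Local Notation Q := quot_mod.
Local Open Scope quotient_scope.

Definition quot_scale (x : R) (q : Q) : Q := \pi_Q (x *: repr q).

Lemma pi_quot_scale (x : R) (m : M) :
  quot_scale x (\pi_Q m) = \pi_Q (x *: m).
Proof.
apply/eqP; rewrite /quot_scale -Quotient.idealrBE -scalerBr.
apply: (@rpredZ _ _ N); suff: repr (\pi_Q m) - m \in submod_zmod by [].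
by rewrite Quotient.idealrBE reprK.
Qed.

Lemma quot_scaleA x y q :
  quot_scale x (quot_scale y q) = quot_scale (x * y) q.
Proof. by rewrite -[q]reprK (pi_quot_scale y) !pi_quot_scale scalerA. Qed.

Lemma quot_scale1 : left_id 1 quot_scale.
Proof. by move=> q; rewrite -[q]reprK pi_quot_scale scale1r. Qed.

Lemma quot_scaleDr : right_distributive quot_scale +%R.
Proof.
move=> x p q; rewrite -[p]reprK -[q]reprK -raddfD !pi_quot_scale.
by rewrite -raddfD scalerDr.
Qed.

Lemma quot_scaleDl q : {morph quot_scale^~ q : x y / x + y}.
Proof. by move=> x y; rewrite -[q]reprK !pi_quot_scale -raddfD scalerDl. Qed.

HB.instance Definition _ := GRing.Zmodule_isLmodule.Build R Q
  quot_scaleA quot_scale1 quot_scaleDr quot_scaleDl.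

End Modules.

(* The two-sided ideal generated by X, as a submodule of the left module R.    *)
Definition ideal_gen (R : nzRingType) (X : R -> Prop) : submodClosed R^o :=
  span_mod (fun y : R^o => exists x b : R, X x /\ y = x * b).

(* The submodule (l_1, ..., l_s) M.                                            *)
Definition seq_mod (R : nzRingType) (M : lmodType R) (ls : seq R) :
    submodClosed M :=
  span_mod (fun m : M => exists2 l, l \in ls & exists m', m = l *: m').

Section Depth.
Variables (k : fieldType) (n : nat).
Local Notation E := (extalg k n).

(* {m | l m = 0} = l M; membership of l in E_1 is part of regular_seq.         *)
Definition regular_elt (M : lmodType E) (l : E) : Prop :=
  forall m : M, l *: m = 0 <-> exists m', m = l *: m'.

Definition regular_seq (M : lmodType E) (ls : seq E) : Prop :=
  {in ls, forall l : E, l \in ext_homog 1} /\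
  forall i, (i < size ls)%N ->
    regular_elt (quot_mod (seq_mod M (take i ls))) (nth 0 ls i).

Definition is_depth (M : lmodType E) (d : nat) : Prop :=
  (exists2 ls, size ls = d & regular_seq M ls) /\
  (forall ls, regular_seq M ls -> (size ls <= d)%N).

End Depth.

Record sgraph (n : nat) := SGraph {
  adj : rel 'I_n;
  adj_sym : symmetric adj;
  adj_irr : irreflexive adj }.

Section Graphs.
Variables (n : nat) (G : sgraph n).

Definition is_complete (m : nat) : Prop :=
  n = m /\ forall u v, adj G u v = (u != v).

Definition is_complete_partite (ns : seq nat) : Prop :=
  exists part : 'I_n -> 'I_(size ns),
    (forall i, #|[set v | part v == i]| = nth 0%N ns i) /\
    (forall u v, adj G u v = (part u != part v)).

(* G is K_(n_1, ..., n_r). With a single index, K_m is the complete graph on m *)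
(* vertices, not the edgeless complete 1-partite graph.                        *)
Definition is_K (ns : seq nat) : Prop :=
  if ns is [:: m] then is_complete m else is_complete_partite ns.

Variable k : fieldType.

Definition edge_ideal : submodClosed (extalg k n)^o :=
  ideal_gen (fun x : extalg k n => exists i j,
    adj G i j /\ x = ext_gen k i * ext_gen k j).

Definition is_graph_depth (d : nat) : Prop :=
  is_depth (quot_mod edge_ideal) d.

End Graphs.

(* Main.v *)
Require Import Defs.
From mathcomp Require Import all_boot all_order all_algebra.
From HB Require Import structures.
From mathcomp Require Import boolp.

Set Implicit Arguments.
Unset Strict Implicit.
Unset Printing Implicit Defensive.

(** In a complete multipartite graph, a product of two linear forms that are
    supported on different parts lies in the edge ideal I.  Let l be a linear
    form and l_p its component on the part p.  Modulo I, multiplication by l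
    agrees with multiplication by l_p on every linear form m supported on p, so
    l kills m as soon as l_p * m = 0.  Two choices of m follow:
    - if l_p = 0, then m may be any nonzero linear form on p;
    - in general, m = l_p works, since linear forms have square zero.
    The ideal I vanishes in degrees 0 and 1, so if m is a multiple of l modulo
    I, then m is a scalar multiple of l.  Suppose that l is regular.  The first
    choice rules out l_p = 0, so every component of l is nonzero.  By the second
    choice l_p is then a scalar multiple of l; with at least two parts, the
    coefficients on another part make this scalar 0, so l_p = 0, a
    contradiction.  Hence no linear form is regular and the depth is 0.

    The argument is [multipartite_not_regular]; it rests on [lin_mul_mem] (l
    kills m) and [edge_ideal_low] (I starts in degree 2).  Complete graphs fit
    the same pattern, each vertex being a part. *)

Import GRing.Theory.
Local Open Scope ring_scope.

(** * Sums of anticommuting elements *)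

(** The cross terms cancel in pairs.  Square-zero is a separate hypothesis
    because anticommutation of x i with itself only gives 2 * x i * x i = 0. *)
Lemma sqr_sum_anticomm (R : nzRingType) (I : Type) (r : seq I) (x : I -> R) :
  (forall i, x i * x i = 0) -> (forall i j, x i * x j = - (x j * x i)) ->
  (\sum_(i <- r) x i) * (\sum_(i <- r) x i) = 0.
Proof.
move=> x2 xC; elim: r => [|a r IHr]; first by rewrite big_nil mul0r.
rewrite big_cons mulrDl !mulrDr x2 IHr add0r addr0 mulr_sumr mulr_suml.
by rewrite -big_split big1 // => i _; rewrite /= xC addNr.
Qed.

(** * Quotient modules *)

Section Quotients.
Variables (R : nzRingType) (M : lmodType R).

Lemma span_mod_min (X : M -> Prop) (N : submodClosed M) m :
  (forall x, X x -> x \in N) -> m \in span_mod X -> m \in N.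
Proof. by move=> XN /asboolP; apply. Qed.

Lemma mem_span_mod (X : M -> Prop) x : X x -> x \in span_mod X.
Proof. by move=> Xx; apply/asboolP => N; apply. Qed.

Section Projection.
Variable N : submodClosed M.

(** The canonical surjection, with its target typed as a module, so that [*:]
    applies to its values. *)
Definition quot_proj (m : M) : quot_mod N := (\pi_(quot_mod N) m)%qT.

Lemma quot_proj_surj (q : quot_mod N) : exists m, q = quot_proj m.
Proof. by exists (repr q); rewrite /quot_proj reprK. Qed.

Lemma quot_projB m m' : quot_proj (m - m') = quot_proj m - quot_proj m'.
Proof. exact: raddfB. Qed.

Lemma quot_projZ (x : R) (m : M) : quot_proj (x *: m) = x *: quot_proj m.
Proof. by rewrite /quot_proj -pi_quot_scale. Qed.

Lemma quot_proj_eq0 (m : M) : quot_proj m = 0 <-> m \in N.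
Proof.
have -> : (m \in N) = (quot_proj m == quot_proj 0).
  by rewrite /quot_proj -Quotient.idealrBE subr0.
have -> : quot_proj 0 = 0 by exact: raddf0.
by split=> /eqP.
Qed.

End Projection.

Definition zero_mod : {pred M} := fun m => m == 0.

Lemma zero_mod_closed : submod_closed zero_mod.
Proof.
split=> [|x u v /eqP-> /eqP->]; first exact: eqxx.
by rewrite scaler0 addr0; exact: eqxx.
Qed.

HB.instance Definition _ := GRing.isSubmodClosed.Build R M zero_mod
  zero_mod_closed.

(** The first element of a regular sequence is tested on M / 0, a quotient that
    is not literally M. *)
Lemma seq_mod_nil (m : M) : m \in seq_mod M [::] -> m = 0.
Proof.
by move=> ms; apply/eqP; apply: (span_mod_min (N := zero_mod)) ms => x [].
Qed.

End Quotients.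

(** * The edge ideal in low degrees *)

Section Exterior.
Variables (k : fieldType) (n : nat).
Local Notation E := (extalg k n).
Implicit Types (a b l : E) (c d : 'I_n -> k).

(** The elements of order at least 2: a submodule that contains the edge ideal
    and in which membership can be read off coordinates. *)
Definition low_zero : {pred E^o} :=
  fun a => [forall S : {set 'I_n}, (#|S| <= 1)%N ==> (a S == 0)].

(** A coordinate of a product at S only involves coordinates of the factors at
    subsets of S.  The case of a serves for the ideal generators x * b, that of b
    for closure under scaling. *)
Lemma low_zeroM a b (S : {set 'I_n}) :
  a \in low_zero \/ b \in low_zero -> (#|S| <= 1)%N -> (a * b) S = 0.
Proof.
move=> ab0 S1; rewrite ffunE big1 // => A _; rewrite big1 // => B _.
rewrite /ext_coef; case: andP => [[_ /eqP US]|]; last by rewrite mulr0.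
have sub : (A \subset S) && (B \subset S) by rewrite -US subsetUl subsetUr.
have /andP[/subset_leq_card AS /subset_leq_card BS] := sub.
case: ab0 => /forallP z0.
  by have /implyP/(_ (leq_trans AS S1))/eqP-> := z0 A; rewrite !mul0r.
by have /implyP/(_ (leq_trans BS S1))/eqP-> := z0 B; rewrite mulr0 mul0r.
Qed.

Lemma low_zero_closed : @submod_closed E E^o low_zero.
Proof.
split=> [|x u v u0 /forallP v0]; apply/forallP => S; apply/implyP => S1.
  by rewrite ffunE.
rewrite ffunE (low_zeroM (a := x) (b := u)) ?add0r //; last by right.
exact: (implyP (v0 S)).
Qed.

HB.instance Definition _ := GRing.isSubmodClosed.Build E E^o low_zero
  low_zero_closed.

(** The generators e_u e_v have degree 2, so every element of the edge ideal has
    order at least 2; irreflexivity gives u != v, hence two distinct indices. *)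
Lemma edge_ideal_low (G : sgraph n) (a : E) (i : 'I_n) :
  a \in edge_ideal G k -> a [set i] = 0.
Proof.
move=> aI; suff /forallP/(_ [set i]) : a \in low_zero by rewrite cards1 => /eqP.
apply: (span_mod_min (N := low_zero)) aI => _ [_ [b [[u [v [uv ->]]] ->]]].
apply/forallP => S; apply/implyP => S1; apply/eqP; apply: low_zeroM => //.
left; rewrite ext_basisM; apply/forallP => T; apply/implyP => T1.
case: ifP => _; rewrite !ffunE //.
have neq_uv : u != v by apply: contraTneq uv => ->; rewrite adj_irr.
case: (T =P _) T1 => [->|_ _]; last by rewrite scaler0.
by rewrite cards2 neq_uv.
Qed.

(** * Linear forms *)

Lemma homog1_sum l : l \in ext_homog 1 ->
  l = \sum_i l [set i] *: ext_gen k i.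
Proof.
move=> /forallP l1; apply/ffunP => S; rewrite sum_ffunE.
have [/cards1P[j ->]|S1] := boolP (#|S| == 1%N).
  rewrite (bigD1 j) //= big1 => [|i ij]; rewrite !ffunE ?eqxx ?addr0.
    by rewrite /GRing.scale /= mulr1.
  by rewrite (inj_eq set1_inj) eq_sym (negPf ij) scaler0.
have /implyP/contra/(_ S1) := l1 S; rewrite negbK => /eqP->.
rewrite big1 // => i _; rewrite !ffunE; case: (S =P _) S1 => [->|_ _].
  by rewrite cards1.
by rewrite scaler0.
Qed.

Lemma lin_coef c (P : pred 'I_n) j :
  (\sum_(i | P i) c i *: ext_gen k i : E) [set j] = if P j then c j else 0.
Proof.
have eq1 i : (c i *: ext_gen k i : E) [set j] = if i == j then c j else 0.
  rewrite !ffunE (inj_eq set1_inj) eq_sym.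
  by case: eqP => [->|_]; rewrite /GRing.scale /= ?mulr1 ?mulr0.
rewrite sum_ffunE; under eq_bigr do rewrite eq1.
rewrite -big_mkcondr; case: ifP => Pj.
  by rewrite (big_pred1 j) // => i /=; rewrite andbC; case: eqP => // ->.
by rewrite big_pred0 // => i; rewrite andbC; case: eqP => // ->.
Qed.

(** In degree 1, a multiple l * b only sees the constant term of b: this is why
    a linear form that is a multiple of l must be a scalar multiple of l. *)
Lemma homog1_mul_coef l b i : l \in ext_homog 1 ->
  (l * b) [set i] = l [set i] * b set0.
Proof.
move=> /forallP l1; rewrite ffunE (bigD1 [set i]) //= [X in _ + X]big1 ?addr0.
  rewrite (bigD1 set0) //= [X in _ + X]big1 ?addr0 => [|T T0].
    by rewrite /ext_coef setI0 setU0 !eqxx ext_inv0r mulr1.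
  rewrite /ext_coef; case: andP => [[/eqP iT /eqP UT]|]; last by rewrite mulr0.
  case/eqP: T0; apply/eqP; rewrite -subset0 -iT subsetI subxx andbT.
  by rewrite -UT subsetUr.
move=> S Si; rewrite big1 // => T _.
rewrite /ext_coef; case: andP => [[_ /eqP UT]|]; last by rewrite mulr0.
have [->|lS] := eqVneq (l S) 0; first by rewrite !mul0r.
have /cards1P[j Sj] := implyP (l1 S) lS.
have : S \subset [set i] by rewrite -UT subsetUl.
by rewrite Sj sub1set inE => /eqP ji; rewrite Sj ji eqxx in Si.
Qed.

Lemma lin_sqr c (P : pred 'I_n) :
  (\sum_(i | P i) c i *: ext_gen k i) * (\sum_(i | P i) c i *: ext_gen k i)
    = 0 :> E.
Proof.
rewrite -big_filter; apply: sqr_sum_anticomm => [i|i j];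
  rewrite -!scalerAl -!scalerAr ?ext_gen_sqr ?scaler0 //.
by rewrite ext_gen_anticomm !scalerN scalerA mulrC -scalerA.
Qed.

Lemma edge_mul_mem (G : sgraph n) (x y : k) i j : adj G i j ->
  (x *: ext_gen k i) * (y *: ext_gen k j) \in edge_ideal G k.
Proof.
move=> ij; apply: mem_span_mod.
exists (ext_gen k i * ext_gen k j), ((x * y)%:A); split; first by exists i, j.
by rewrite -scalerAl -!scalerAr mulr1 scalerA.
Qed.

(** * Depth of complete multipartite graphs *)

(** The components of the first factor outside the part p only contribute
    products over edges, so the product is governed by the component on p. *)
Lemma lin_mul_mem (G : sgraph n) (C : eqType) (part : 'I_n -> C) c d p :
  (forall u v, adj G u v = (part u != part v)) ->
  (\sum_(i | part i == p) c i *: ext_gen k i) *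
    (\sum_(i | part i == p) d i *: ext_gen k i) = 0 ->
  (\sum_i c i *: ext_gen k i) * (\sum_(i | part i == p) d i *: ext_gen k i)
    \in edge_ideal G k.
Proof.
move=> Gpart cd0; rewrite (bigID (fun i => part i == p)) /= mulrDl cd0 add0r.
rewrite mulr_suml; apply: rpred_sum => i ip.
rewrite mulr_sumr; apply: rpred_sum => j /eqP jp.
by apply: edge_mul_mem; rewrite Gpart jp.
Qed.

(** The half of regularity that fails, pulled back to the exterior algebra: an
    element killed by l modulo the edge ideal is a multiple of l modulo it. *)
Lemma regular_elt_edge (G : sgraph n) l (m : E) :
  let M := quot_mod (edge_ideal G k) in
  regular_elt (quot_mod (seq_mod M [::])) l -> l * m \in edge_ideal G k ->
  exists m' : E, m - l * m' \in edge_ideal G k.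
Proof.
move=> M reg lm.
pose p := quot_proj (seq_mod M [::]).
pose pI (x : E) : M := quot_proj (edge_ideal G k) x.
have /reg[q] : l *: p (pI m) = 0.
  rewrite -quot_projZ -quot_projZ; apply/quot_proj_eq0.
  by have /quot_proj_eq0-> := lm; exact: rpred0.
have [q1 ->] := quot_proj_surj q; have [m' ->] := quot_proj_surj q1.
rewrite -!quot_projZ => /eqP; rewrite -subr_eq0 -quot_projB => /eqP.
move=> /quot_proj_eq0/seq_mod_nil/eqP; rewrite -quot_projB => /eqP.
by move=> /quot_proj_eq0; exists m'.
Qed.

(** The components of l on the parts of u and v give the contradiction: both
    must be nonzero, yet the first would be a scalar multiple of l.  The parts
    are the fibres of a labelling by an arbitrary type, which covers both the
    multipartite graphs, labelled by part indices, and K_n, labelled by the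
    vertices themselves. *)
Lemma multipartite_not_regular (G : sgraph n) (C : eqType) (part : 'I_n -> C)
    u v l :
  (forall u v, adj G u v = (part u != part v)) -> part u != part v ->
  l \in ext_homog 1 ->
  ~ regular_elt (quot_mod (seq_mod (quot_mod (edge_ideal G k)) [::])) l.
Proof.
move=> Gpart uv l1 reg; set c := fun i => l [set i].
(* Write l_p for the part of l supported on the label p.  A linear form on p
   killed by l_p is killed by l modulo the edge ideal, so it is x * l. *)
have prop (d : 'I_n -> k) p :
    (\sum_(i | part i == p) c i *: ext_gen k i) *
      (\sum_(i | part i == p) d i *: ext_gen k i) = 0 :> E ->
    exists x, forall i, (if part i == p then d i else 0) = c i * x.
  move=> /(lin_mul_mem Gpart); rewrite -homog1_sum // => lm.
  have [m' mI] := regular_elt_edge reg lm.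
  exists (m' set0) => i; have := edge_ideal_low i mI.
  have coefB (a b : E) S : (a - b) S = a S - b S by rewrite !ffunE.
  rewrite coefB lin_coef homog1_mul_coef // => /eqP.
  by rewrite subr_eq0 => /eqP.
(* Otherwise l_p = 0, where p is the part of w, and this kills the sum of the
   generators of p; that sum is then a multiple of l, which vanishes on p. *)
have nz w : exists2 i, part i = part w & c i != 0.
  apply: contrapT => cw0.
  have c0 i : part i = part w -> c i = 0.
    by move=> iw; apply: contrapT => /eqP ci; apply: cw0; exists i.
  have [|x /(_ w)] := prop (fun=> 1) (part w).
    by rewrite big1 ?mul0r // => i /eqP/c0->; rewrite scale0r.
  by rewrite eqxx c0 // mul0r => /eqP; rewrite oner_eq0.
(* l_p is killed by l_p, hence equals x * l; the part of v forces x = 0. *)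
have [x cx] := prop c (part u) (lin_sqr _ _).
have [j jv cj] := nz v; have [i iu ci] := nz u.
have := cx j; rewrite jv eq_sym (negPf uv) => /esym/eqP.
rewrite mulf_eq0 (negPf cj) /= => /eqP x0.
by have /eqP := cx i; rewrite iu eqxx x0 mulr0 (negPf ci).
Qed.

Lemma multipartite_depth0 (G : sgraph n) (C : eqType) (part : 'I_n -> C) u v :
  (forall u v, adj G u v = (part u != part v)) -> part u != part v ->
  is_graph_depth G k 0.
Proof.
move=> Gpart uv; split; first by exists [::].
case=> // l ls [ls1 /(_ 0%N isT)] /= reg.
by case: (multipartite_not_regular Gpart uv (ls1 l (mem_head _ _)) reg).
Qed.

End Exterior.

Theorem corollary3p10 (k : closedFieldType)
    (k_char0 : [pchar k]%R =i pred0)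
    (ns : seq nat) (ns_neq0 : ns <> [::]) (ns_gt0 : all (leq 1) ns)
    (n : nat) (G : sgraph n) (GK : is_K G ns) (GneqK1 : ~ is_complete G 1) :
  is_graph_depth G k 0.
Proof.
case: ns ns_neq0 ns_gt0 GK => [//|m [|m' ns]] _.
  case: m => [//|[|m]] _ GK; first by case: GneqK1.
  case: GK => en Gc; rewrite en in G Gc GneqK1 *.
  exact: (multipartite_depth0 (u := ord0) (v := ord_max) k Gc).
move=> ns_gt0 [part [card_part Gpart]].
have ex (p : 'I_(size [:: m, m' & ns])) : exists u, part u = p.
  have : (0 < #|[set v | part v == p]|)%N.
    by rewrite card_part; apply: (allP ns_gt0); apply: mem_nth.
  by case/card_gt0P => u; rewrite inE => /eqP; exists u.
have [u u0] := ex ord0; have [v v1] := ex ord_max.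
by apply: (multipartite_depth0 (u := u) (v := v) k Gpart); rewrite u0 v1.
Qed.
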